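(* Let $V$ be a separable right quaternionic Hilbert space. For every $A\in B(V)$, with Berberian extension $A^\circ\in B(\mathfrak H)$, one has $$\sigma^S_{ap}(A)=\sigma^S_{ap}(A^\circ)=\sigma_{pS}(A^\circ).$$
   Context: $\mathbb H$ denotes the quaternions, with conjugation $\overline{\mathfrak q}$, real part $\mathrm{Re}(\mathfrak q)$ and norm $|\mathfrak q|$. A right quaternionic Hilbert space is a right $\mathbb H$-vector space, complete for the norm $\|\phi\|=\langle\phi|\phi\rangle^{1/2}$, with an $\mathbb H$-valued inner product that is additive in each variable and satisfies $\overline{\langle\phi|\psi\rangle}=\langle\psi|\phi\rangle$, $\langle\phi|\psi\mathfrak q\rangle=\langle\phi|\psi\rangle\mathfrak q$, $\langle\phi\mathfrak q|\psi\rangle=\overline{\mathfrak q}\langle\phi|\psi\rangle$ and $\langle\phi|\phi\rangle>0$ for $\phi\neq0$. For such a space $W$, $B(W)$ is the set of bounded everywhere-defined right $\mathbb H$-linear operators $W\to W$, with the operator norm. S-spectra. For $A\in B(W)$ and $\mathfrak q\in\mathbb H$ put $R_{\mathfrak q}(A)=A^2-2\,\mathrm{Re}(\mathfrak q)A+|\mathfrak q|^2 I_W$. Then $\sigma_{pS}(A)=\{\mathfrak q\in\mathbb H:\ker R_{\mathfrak q}(A)\neq\{0\}\}$ (point S-spectrum) and $\sigma^S_{ap}(A)=\{\mathfrak q\in\mathbb H:$ there is a sequence $(\phi_n)$ in $W$ with $\|\phi_n\|=1$ and $\|R_{\mathfrak q}(A)\phi_n\|\to0\}$ (approximate point S-spectrum).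 Berberian extension. Fix a Banach generalized limit $\mathrm{glim}$, i.e. a map from bounded sequences in $\mathbb H$ to $\mathbb H$ such that: $\mathrm{glim}(\mathfrak q_n+\mathfrak p_n)=\mathrm{glim}(\mathfrak q_n)+\mathrm{glim}(\mathfrak p_n)$; $\mathrm{glim}(\mathfrak q_n\mathfrak q)=\mathrm{glim}(\mathfrak q_n)\mathfrak q$; $\mathrm{glim}(\mathfrak q\mathfrak q_n)=\mathfrak q\,\mathrm{glim}(\mathfrak q_n)$; $\mathrm{glim}(\mathfrak q_n)=\lim\mathfrak q_n$ if the sequence converges; $\mathrm{glim}(\mathfrak q_n)\ge0$ if all $\mathfrak q_n$ are real and $\ge0$. Let $\mathcal B$ be the right $\mathbb H$-vector space (componentwise operations) of norm-bounded sequences in $V$. Put $\Phi(\{\phi_n\},\{\psi_n\})=\mathrm{glim}\langle\phi_n|\psi_n\rangle_V$ and $\mathfrak N=\{s\in\mathcal B:\Phi(s,s)=0\}$, a right linear subspace. Let $\mathfrak P=\mathcal B/\mathfrak N$ with inner product $\langle[s]|[t]\rangle=\Phi(s,t)$, and let $\mathfrak H$ be the Hilbert space completion of $\mathfrak P$. For $A\in B(V)$, the Berberian extension $A^\circ\in B(\mathfrak H)$ is the unique continuous extension to $\mathfrak H$ of the well-defined bounded right linear map $\mathfrak P\to\mathfrak P$, $[\{\phi_n\}]\mapsto[\{A\phi_n\}]$. *)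

(* Defs.v *)
From HB Require Import structures.
From mathcomp Require Import all_boot all_order all_algebra.
From mathcomp Require Import generic_quotient ring_quotient.
From mathcomp Require Import ring lra.
From mathcomp Require Import all_classical all_reals all_analysis.

Set Implicit Arguments.
Unset Strict Implicit.
Unset Printing Implicit Defensive.
Import Order.TTheory GRing.Theory Num.Theory.
Import numFieldNormedType.Exports.
Local Open Scope classical_set_scope.
Local Open Scope ring_scope.

(* Quat a b c d is a + b i + c j + d k. *)
Record quat (R : Type) := Quat { qre : R; qi : R; qj : R; qk : R }.

Section QuatChoice.
Variable R : choiceType.
Definition quat_to (p : quat R) : R * R * R * R := (qre p, qi p, qj p, qk p).
Definition quat_of (x : R * R * R * R) : quat R :=
  let: (a, b, c, d) := x in Quat a b c d.
Lemma quat_toK : cancel quat_to quat_of. Proof. by case. Qed.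
HB.instance Definition _ := Choice.copy (quat R) (can_type quat_toK).
End QuatChoice.

Lemma quat_eqP (R : Type) (p q : quat R) :
  qre p = qre q -> qi p = qi q -> qj p = qj q -> qk p = qk q -> p = q.
Proof. by case: p q => [? ? ? ?] [? ? ? ?] /= -> -> -> ->. Qed.

Section QuatRing.
Variable R : realType.
Implicit Types p q r : quat R.

Definition quat_add p q :=
  Quat (qre p + qre q) (qi p + qi q) (qj p + qj q) (qk p + qk q).
Definition quat_opp p := Quat (- qre p) (- qi p) (- qj p) (- qk p).
Definition quat_mul p q := Quat
  (qre p * qre q - qi p * qi q - qj p * qj q - qk p * qk q)
  (qre p * qi q + qi p * qre q + qj p * qk q - qk p * qj q)
  (qre p * qj q - qi p * qk q + qj p * qre q + qk p * qi q)
  (qre p * qk q + qi p * qj q - qj p * qi q + qk p * qre q).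
Definition qreal (a : R) : quat R := Quat a 0 0 0.

Fact quat_addA : associative quat_add.
Proof. by move=> p q r; apply: quat_eqP => /=; rewrite addrA. Qed.
Fact quat_addC : commutative quat_add.
Proof. by move=> p q; apply: quat_eqP => /=; rewrite addrC. Qed.
Fact quat_add0 : left_id (qreal 0) quat_add.
Proof. by move=> p; apply: quat_eqP => /=; rewrite add0r. Qed.
Fact quat_addN : left_inverse (qreal 0) quat_opp quat_add.
Proof. by move=> p; apply: quat_eqP => /=; rewrite addNr. Qed.
HB.instance Definition _ :=
  GRing.isZmodule.Build (quat R) quat_addA quat_addC quat_add0 quat_addN.

Fact quat_mulA : associative quat_mul.
Proof. by move=> p q r; apply: quat_eqP => /=; ring. Qed.
Fact quat_mul1 : left_id (qreal 1) quat_mul.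
Proof. by move=> p; apply: quat_eqP => /=; ring. Qed.
Fact quat_mulr1 : right_id (qreal 1) quat_mul.
Proof. by move=> p; apply: quat_eqP => /=; ring. Qed.
Fact quat_mulDl : left_distributive quat_mul quat_add.
Proof. by move=> p q r; apply: quat_eqP => /=; ring. Qed.
Fact quat_mulDr : right_distributive quat_mul quat_add.
Proof. by move=> p q r; apply: quat_eqP => /=; ring. Qed.
Fact quat_1neq0 : qreal 1 != 0 :> quat R.
Proof. by apply/eqP => -[/eqP]; rewrite oner_eq0. Qed.
HB.instance Definition _ := GRing.Zmodule_isNzRing.Build (quat R)
  quat_mulA quat_mul1 quat_mulr1 quat_mulDl quat_mulDr quat_1neq0.

Definition qconj p := Quat (qre p) (- qi p) (- qj p) (- qk p).
Definition qabs p :=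
  Num.sqrt (qre p ^+ 2 + qi p ^+ 2 + qj p ^+ 2 + qk p ^+ 2).

Lemma qreD p q : qre (p + q) = qre p + qre q. Proof. by []. Qed.
Lemma qreN p : qre (- p) = - qre p. Proof. by []. Qed.
Lemma qreB p q : qre (p - q) = qre p - qre q. Proof. by []. Qed.
Lemma qre0 : qre (0 : quat R) = 0. Proof. by []. Qed.
Lemma qconjD p q : qconj (p + q) = qconj p + qconj q.
Proof. by apply: quat_eqP => //=; rewrite opprD. Qed.
Lemma qconjN p : qconj (- p) = - qconj p.
Proof. by apply: quat_eqP. Qed.
Lemma qconjK : involutive qconj.
Proof. by move=> p; apply: quat_eqP => //=; rewrite opprK. Qed.
Lemma qconjM p q : qconj (p * q) = qconj q * qconj p.
Proof. by apply: quat_eqP => /=; ring. Qed.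
Lemma qconj_real a : qconj (qreal a) = qreal a.
Proof. by apply: quat_eqP => //=; rewrite oppr0. Qed.
Lemma qconj0 : qconj 0 = 0. Proof. exact: qconj_real. Qed.
Lemma qrealD a b : qreal (a + b) = qreal a + qreal b.
Proof. by apply: quat_eqP => //=; rewrite addr0. Qed.
Lemma qrealM a b : qreal (a * b) = qreal a * qreal b.
Proof. by apply: quat_eqP => /=; ring. Qed.
Lemma qrealC a p : qreal a * p = p * qreal a.
Proof. by apply: quat_eqP => /=; ring. Qed.

Lemma qabs_sqr p : qabs p ^+ 2 = qre p ^+ 2 + qi p ^+ 2 + qj p ^+ 2 + qk p ^+ 2.
Proof. by rewrite sqr_sqrtr // !addr_ge0 ?sqr_ge0. Qed.
Lemma qabs_ge0 p : 0 <= qabs p. Proof. exact: sqrtr_ge0. Qed.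
Lemma qmulconj p : p * qconj p = qreal (qabs p ^+ 2).
Proof. by rewrite qabs_sqr; apply: quat_eqP => /=; ring. Qed.
Lemma qconjmul p : qconj p * p = qreal (qabs p ^+ 2).
Proof. by rewrite qabs_sqr; apply: quat_eqP => /=; ring. Qed.
Lemma qabsM p q : qabs (p * q) = qabs p * qabs q.
Proof.
apply/eqP; rewrite -(@eqrXn2 _ 2) ?mulr_ge0 ?qabs_ge0 //.
by rewrite exprMn !qabs_sqr /=; apply/eqP; ring.
Qed.
Lemma qabs_conj p : qabs (qconj p) = qabs p.
Proof. by rewrite /qabs /= !sqrrN. Qed.
Lemma qabsN p : qabs (- p) = qabs p.
Proof. by rewrite /qabs /= !sqrrN. Qed.
Lemma qabs0 : qabs 0 = 0.
Proof. by rewrite /qabs /= !expr0n /= !addr0 sqrtr0. Qed.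
Lemma qabs_real a : qabs (qreal a) = `|a|.
Proof. by rewrite /qabs /= !expr0n /= !addr0 sqrtr_sqr. Qed.
Lemma ler_sqrP (a b : R) : 0 <= b -> a ^+ 2 <= b ^+ 2 -> a <= b.
Proof.
move=> b0 h; case: (lerP 0 a) => [a0|/ltW a0]; last exact: le_trans b0.
by rewrite -(@ler_pXn2r _ 2) ?nnegrE.
Qed.
Lemma qabs_re p : `|qre p| <= qabs p.
Proof.
apply: ler_sqrP (qabs_ge0 _) _; rewrite qabs_sqr real_normK ?num_real //.
by rewrite -!addrA lerDl !addr_ge0 ?sqr_ge0.
Qed.
Lemma qabs_i p : `|qi p| <= qabs p.
Proof.
apply: ler_sqrP (qabs_ge0 _) _; rewrite qabs_sqr real_normK ?num_real //.
by have := sqr_ge0 (qre p); have := sqr_ge0 (qj p); have := sqr_ge0 (qk p); lra.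
Qed.
Lemma qabs_j p : `|qj p| <= qabs p.
Proof.
apply: ler_sqrP (qabs_ge0 _) _; rewrite qabs_sqr real_normK ?num_real //.
by have := sqr_ge0 (qre p); have := sqr_ge0 (qi p); have := sqr_ge0 (qk p); lra.
Qed.
Lemma qabs_k p : `|qk p| <= qabs p.
Proof.
apply: ler_sqrP (qabs_ge0 _) _; rewrite qabs_sqr real_normK ?num_real //.
by have := sqr_ge0 (qre p); have := sqr_ge0 (qi p); have := sqr_ge0 (qj p); lra.
Qed.
Lemma qabsD p q : qabs (p + q) <= qabs p + qabs q.
Proof.
apply: ler_sqrP; first by rewrite addr_ge0 ?qabs_ge0.
have := qabs_re (p * qconj q); rewrite qabsM qabs_conj => h.
have := le_trans (ler_norm _) h; rewrite /= sqrrD !qabs_sqr /=; lra.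
Qed.
Lemma qabs_le1 p : qabs p <= `|qre p| + `|qi p| + `|qj p| + `|qk p|.
Proof.
have E : p = Quat (qre p) 0 0 0 + Quat 0 (qi p) 0 0 + Quat 0 0 (qj p) 0
            + Quat 0 0 0 (qk p) by apply: quat_eqP => /=; ring.
rewrite {1}E.
do 3!(apply: le_trans (qabsD _ _) _; apply: lerD;
      last by rewrite /qabs /= !expr0n /= ?add0r ?addr0 sqrtr_sqr).
by rewrite /qabs /= !expr0n /= ?add0r ?addr0 sqrtr_sqr.
Qed.
Lemma qabs_eq0 p : qabs p = 0 -> p = 0.
Proof.
move=> p0; move: (qabs_re p) (qabs_i p) (qabs_j p) (qabs_k p).
rewrite p0 !normr_le0 => /eqP ? /eqP ? /eqP ? /eqP ?.
exact: quat_eqP.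
Qed.
End QuatRing.

(* Right quaternionic vector spaces are left modules over the converse ring
   of the quaternions, so [v *> q] is the vector usually written v q. *)
Notation "v *> q" := (GRing.scale (q : (quat _)^c) v)
  (at level 40, left associativity, only parsing) : ring_scope.

HB.mixin Record isQSemiInner (R : realType) V of GRing.Lmodule (quat R)^c V := {
  qdot : V -> V -> quat R;
  qdotDl : forall u v w, qdot (u + v) w = qdot u w + qdot v w;
  qdotDr : forall u v w, qdot u (v + w) = qdot u v + qdot u w;
  qdotC : forall u v, qconj (qdot u v) = qdot v u;
  qdotZr : forall u v (q : quat R), qdot u (v *> q) = qdot u v * q;
  qdotZl : forall u v (q : quat R), qdot (u *> q) v = qconj q * qdot u v;
  qdot_ge0 : forall u, 0 <= qre (qdot u u)
}.

#[short(type="qSemiType")]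
HB.structure Definition QSemi (R : realType) :=
  {V of isQSemiInner R V & GRing.Lmodule (quat R)^c V}.

(* By [qdotC] the quaternion [qdot u u] is real, so positivity is a condition
   on its real part. *)
HB.mixin Record isQDefinite (R : realType) V of QSemi R V := {
  qdot_gt0 : forall u : V, u != 0 -> 0 < qre (qdot u u)
}.

#[short(type="qPreHilbertType")]
HB.structure Definition QPreHilbert (R : realType) :=
  {V of isQDefinite R V & QSemi R V}.

Definition qnorm (R : realType) (V : qSemiType R) (v : V) : R :=
  Num.sqrt (qre (qdot v v)).

Definition qcauchy (R : realType) (V : qSemiType R) (u : nat -> V) :=
  forall e : R, 0 < e ->
    exists N, forall m n, (N <= m)%N -> (N <= n)%N -> qnorm (u m - u n) < e.

Definition qcvg (R : realType) (V : qSemiType R) (u : nat -> V) (l : V) :=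
  (fun n => qnorm (u n - l)) @ \oo --> (0 : R).

HB.mixin Record isQComplete (R : realType) V of QPreHilbert R V := {
  qcomplete : forall u : nat -> V, qcauchy u -> exists l, qcvg u l
}.

#[short(type="qHilbertType")]
HB.structure Definition QHilbert (R : realType) :=
  {V of isQComplete R V & QPreHilbert R V}.

Section SemiTheory.
Variables (R : realType) (V : qSemiType R).
Implicit Types (u v w : V) (p q : quat R).

Lemma qdot0r u : qdot u 0 = 0.
Proof. by apply: (addrI (qdot u 0)); rewrite -qdotDr !addr0. Qed.
Lemma qdot0l u : qdot 0 u = 0.
Proof. by rewrite -qdotC qdot0r qconj0. Qed.
Lemma qdotNr u v : qdot u (- v) = - qdot u v.
Proof. by apply: (addrI (qdot u v)); rewrite -qdotDr !subrr qdot0r. Qed.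
Lemma qdotNl u v : qdot (- u) v = - qdot u v.
Proof. by rewrite -qdotC qdotNr qconjN qdotC. Qed.
Lemma qdotBr u v w : qdot u (v - w) = qdot u v - qdot u w.
Proof. by rewrite qdotDr qdotNr. Qed.
Lemma qdotBl u v w : qdot (u - v) w = qdot u w - qdot v w.
Proof. by rewrite qdotDl qdotNl. Qed.

Lemma qdot_real u : qdot u u = qreal (qre (qdot u u)).
Proof.
have := qdotC u u; case: (qdot u u) => a b c d -[hb hc hd].
by apply: quat_eqP => //=; [move: hb | move: hc | move: hd] => /eqP;
  rewrite eqr_oppLR -subr_eq0 opprK -mulr2n mulrn_eq0 /= => /eqP.
Qed.

Lemma qnorm_ge0 u : 0 <= qnorm u. Proof. exact: sqrtr_ge0. Qed.
Lemma qnorm_sqr u : qnorm u ^+ 2 = qre (qdot u u).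
Proof. by rewrite sqr_sqrtr ?qdot_ge0. Qed.
Lemma qdot_norm u : qdot u u = qreal (qnorm u ^+ 2).
Proof. by rewrite qnorm_sqr -qdot_real. Qed.

Lemma qnorm0 : qnorm (0 : V) = 0.
Proof. by rewrite /qnorm qdot0r qre0 sqrtr0. Qed.
Lemma qnormN u : qnorm (- u) = qnorm u.
Proof. by rewrite /qnorm qdotNl qdotNr opprK. Qed.
Lemma qnormBC u v : qnorm (u - v) = qnorm (v - u).
Proof. by rewrite -qnormN opprB. Qed.
Lemma qnormZ u q : qnorm (u *> q) = qnorm u * qabs q.
Proof.
apply/eqP; rewrite -(@eqrXn2 _ 2) ?mulr_ge0 ?qabs_ge0 ?qnorm_ge0 //.
rewrite qnorm_sqr qdotZr qdotZl -mulrA qdot_norm qrealC mulrA qconjmul.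
by rewrite -qrealM exprMn mulrC.
Qed.

Lemma qdot_le u v : qabs (qdot u v) <= qnorm u * qnorm v.
Proof.
apply: ler_sqrP; first by rewrite mulr_ge0 ?qnorm_ge0.
set a := qabs (qdot u v).
have E t : qnorm (v - u *> (qdot u v * qreal t)) ^+ 2 =
    qnorm v ^+ 2 - a ^+ 2 * (2 * t) + a ^+ 2 * t ^+ 2 * qnorm u ^+ 2.
  rewrite [LHS]qnorm_sqr qdotBl !qdotBr !qdotZr !qdotZl.
  rewrite -[qdot v u]qdotC [qdot u u]qdot_norm [qdot v v]qdot_norm qabs_sqr.
  by case: (qdot u v) => /= *; ring.
have {}E t : 0 <= qnorm v ^+ 2 - a ^+ 2 * (2 * t) + a ^+ 2 * t ^+ 2 * qnorm u ^+ 2.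
  by rewrite -E sqr_ge0.
rewrite exprMn; have [u0|u0] := eqVneq (qnorm u ^+ 2) 0.
  rewrite u0 mul0r; rewrite u0 in E.
  have [->//|a0] := eqVneq (a ^+ 2) 0.
  have := E ((qnorm v ^+ 2 + 1) / (2 * a ^+ 2)).
  have -> : a ^+ 2 * (2 * ((qnorm v ^+ 2 + 1) / (2 * a ^+ 2))) = qnorm v ^+ 2 + 1.
    by field; rewrite -sqrf_eq0.
  by lra.
have := E (qnorm u ^+ 2)^-1.
have -> : qnorm v ^+ 2 - a ^+ 2 * (2 * (qnorm u ^+ 2)^-1)
   + a ^+ 2 * (qnorm u ^+ 2)^-1 ^+ 2 * qnorm u ^+ 2
   = (qnorm u ^+ 2 * qnorm v ^+ 2 - a ^+ 2) / qnorm u ^+ 2.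
  by field; rewrite -sqrf_eq0.
rewrite pmulr_lge0 ?subr_ge0 // invr_gt0 lt_neqAle eq_sym u0.
exact: sqr_ge0.
Qed.

Lemma qnormD u v : qnorm (u + v) <= qnorm u + qnorm v.
Proof.
apply: ler_sqrP; first by rewrite addr_ge0 ?qnorm_ge0.
rewrite qnorm_sqr qdotDl !qdotDr -[qdot v u]qdotC.
rewrite [qdot u u]qdot_norm [qdot v v]qdot_norm !qreD /= sqrrD.
have := le_trans (le_trans (ler_norm _) (qabs_re _)) (qdot_le u v).
by lra.
Qed.

Lemma qnormB u v : qnorm (u - v) <= qnorm u + qnorm v.
Proof. by rewrite -[qnorm v]qnormN qnormD. Qed.

Lemma qnorm_dist u v : `|qnorm u - qnorm v| <= qnorm (u - v).
Proof.
rewrite ler_norml; apply/andP; split.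
  have := qnormD (v - u) u; rewrite subrK qnormBC; lra.
by have := qnormD (u - v) v; rewrite subrK; lra.
Qed.

(* The null vectors of the semi-inner product. *)
Definition qnull : {pred V} := fun u => qdot u u == 0.

Lemma qnullP u : reflect (qnorm u = 0) (u \in qnull).
Proof.
rewrite unfold_in /qnull qdot_norm; apply: (iffP eqP) => [[/eqP]|->].
  by rewrite sqrf_eq0 => /eqP.
by rewrite expr0n.
Qed.

Lemma qnull_dotl u v : u \in qnull -> qdot u v = 0.
Proof.
move=> /qnullP u0; apply: qabs_eq0; apply/eqP; rewrite eq_le qabs_ge0 andbT.
by have := qdot_le u v; rewrite u0 mul0r.
Qed.
Lemma qnull_dotr u v : v \in qnull -> qdot u v = 0.
Proof. by move=> v0; rewrite -qdotC qnull_dotl // qconj0. Qed.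

Fact qnull_zmod_closed : zmod_closed qnull.
Proof.
split=> [|u v u0 v0]; first by apply/qnullP; rewrite qnorm0.
by rewrite unfold_in /qnull qdotBl !(qnull_dotl _ u0) !(qnull_dotl _ v0) subrr.
Qed.
HB.instance Definition _ := GRing.isZmodClosed.Build V qnull qnull_zmod_closed.

Lemma qnullZ u (q : (quat R)^c) : u \in qnull -> q *: u \in qnull.
Proof. by move=> /qnullP u0; apply/qnullP; rewrite qnormZ u0 mul0r. Qed.
End SemiTheory.

(* The quotient of a semi-inner product space by its null vectors. *)
Section SemiQuotient.
Variables (R : realType) (V : qSemiType R).
Local Open Scope quotient_scope.
Import Quotient.

Definition qquot : Type := {quot @qnull R V}.
HB.instance Definition _ := GRing.Zmodule.on qquot.
HB.instance Definition _ := Quotient.on qquot.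

Definition qclass (v : V) : qquot := \pi v.

Lemma qclassK (x : qquot) : qclass (repr x) = x. Proof. exact: reprK. Qed.
Lemma qclassP (u v : V) : reflect (qclass u = qclass v) (u - v \in @qnull R V).
Proof. by rewrite idealrBE; exact: eqP. Qed.
Lemma qclassD (u v : V) : qclass (u + v) = qclass u + qclass v.
Proof. exact: (raddfD (\pi_({quot (@qnull R V)}))). Qed.
Lemma qclass_repr (u : V) : repr (qclass u) - u \in @qnull R V.
Proof. by apply/qclassP; rewrite qclassK. Qed.

Definition qquot_scale (q : (quat R)^c) (x : qquot) := qclass (q *: repr x).

Lemma qquot_scaleE q u : qquot_scale q (qclass u) = qclass (q *: u).
Proof. by apply/qclassP; rewrite -scalerBr qnullZ ?qclass_repr. Qed.

Fact qquot_scaleA a b x :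
  qquot_scale a (qquot_scale b x) = qquot_scale (a * b) x.
Proof. by rewrite -[x]qclassK !qquot_scaleE scalerA. Qed.
Fact qquot_scale1 : left_id 1 qquot_scale.
Proof. by move=> x; rewrite -[x]qclassK qquot_scaleE scale1r. Qed.
Fact qquot_scaleDr : right_distributive qquot_scale +%R.
Proof.
move=> a x y; rewrite -[x]qclassK -[y]qclassK -qclassD !qquot_scaleE.
by rewrite scalerDr qclassD.
Qed.
Fact qquot_scaleDl x : {morph qquot_scale^~ x : a b / a + b}.
Proof. by move=> a b; rewrite -[x]qclassK !qquot_scaleE scalerDl qclassD. Qed.
HB.instance Definition _ := GRing.Zmodule_isLmodule.Build (quat R)^c qquot
  qquot_scaleA qquot_scale1 qquot_scaleDr qquot_scaleDl.

Lemma qclassZ (q : (quat R)^c) (u : V) : qclass (q *: u) = q *: qclass u.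
Proof. by rewrite -qquot_scaleE. Qed.

Fact qclass_linear : linear qclass.
Proof. by move=> q u v; rewrite qclassD qclassZ. Qed.
HB.instance Definition _ :=
  GRing.isLinear.Build (quat R)^c V qquot *:%R qclass qclass_linear.

Lemma qclassB (u v : V) : qclass (u - v) = qclass u - qclass v.
Proof. exact: raddfB. Qed.

Definition qquot_dot (x y : qquot) := qdot (repr x) (repr y).

Lemma qquot_dotE u v : qquot_dot (qclass u) (qclass v) = qdot u v.
Proof.
rewrite /qquot_dot -[X in qdot X _](subrK u) qdotDl qnull_dotl ?qclass_repr //.
by rewrite add0r -[X in qdot _ X](subrK v) qdotDr qnull_dotr ?qclass_repr ?add0r.
Qed.
Fact qquot_dotDl x y z : qquot_dot (x + y) z = qquot_dot x z + qquot_dot y z.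
Proof.
by rewrite -[x]qclassK -[y]qclassK -[z]qclassK -qclassD !qquot_dotE qdotDl.
Qed.
Fact qquot_dotDr x y z : qquot_dot x (y + z) = qquot_dot x y + qquot_dot x z.
Proof.
by rewrite -[x]qclassK -[y]qclassK -[z]qclassK -qclassD !qquot_dotE qdotDr.
Qed.
Fact qquot_dotC x y : qconj (qquot_dot x y) = qquot_dot y x.
Proof. exact: qdotC. Qed.
Fact qquot_dotZr x y (q : quat R) : qquot_dot x (y *> q) = qquot_dot x y * q.
Proof. by rewrite -[x]qclassK -[y]qclassK -qclassZ !qquot_dotE qdotZr. Qed.
Fact qquot_dotZl x y (q : quat R) :
  qquot_dot (x *> q) y = qconj q * qquot_dot x y.
Proof. by rewrite -[x]qclassK -[y]qclassK -qclassZ !qquot_dotE qdotZl. Qed.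
Fact qquot_dot_ge0 x : 0 <= qre (qquot_dot x x).
Proof. exact: qdot_ge0. Qed.
HB.instance Definition _ := isQSemiInner.Build R qquot
  qquot_dotDl qquot_dotDr qquot_dotC qquot_dotZr qquot_dotZl qquot_dot_ge0.

Lemma qdot_class (u v : V) : qdot (qclass u) (qclass v) = qdot u v.
Proof. exact: qquot_dotE. Qed.

Fact qquot_dot_gt0 (x : qquot) : x != 0 -> 0 < qre (qdot x x).
Proof.
rewrite -[x]qclassK qdot_class lt_neqAle qdot_ge0 andbT => /eqP x0.
apply/eqP => r0; apply: x0.
have -> : (0 : qquot) = qclass 0.
  by apply: (addrI (qclass 0)); rewrite -qclassD !addr0.
by apply/qclassP; rewrite subr0 unfold_in /qnull qdot_real -r0.
Qed.
HB.instance Definition _ := isQDefinite.Build R qquot qquot_dot_gt0.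
End SemiQuotient.

Section QuatSeq.
Variable R : realType.
Implicit Types (u v : nat -> quat R) (p q l : quat R).

Definition qseq_bounded u := exists M, forall n, qabs (u n) <= M.
Definition qseq_cvg u l := (fun n => qabs (u n - l)) @ \oo --> (0 : R).

Lemma cvg0P (f : nat -> R) : f @ \oo --> (0 : R) <->
  forall e, 0 < e -> exists N, forall n, (N <= n)%N -> `|f n| < e.
Proof.
split=> [/cvgrPdist_lt h e e0|h]; last apply/cvgrPdist_lt => e e0.
  by have [N _ hN] := h e e0; exists N => n /hN; rewrite sub0r normrN.
have [N hN] := h e e0; exists N => // n /= /hN; by rewrite sub0r normrN.
Qed.

Lemma squeeze0 (f g : nat -> R) : (forall n, 0 <= f n <= g n) ->
  g @ \oo --> (0 : R) -> f @ \oo --> (0 : R).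
Proof.
move=> fg /cvg0P g0; apply/cvg0P => e /g0 [N hN]; exists N => n /hN.
have /andP[f0 h] := fg n; rewrite !ger0_norm //; last exact: le_trans h.
exact: le_lt_trans.
Qed.

Lemma cvg0D (f g : nat -> R) : f @ \oo --> (0 : R) -> g @ \oo --> (0 : R) ->
  (fun n => f n + g n) @ \oo --> (0 : R).
Proof. by move=> f0 g0; rewrite -[0]addr0; exact: cvgD. Qed.
Lemma cvg0M (f : nat -> R) c : f @ \oo --> (0 : R) ->
  (fun n => c * f n) @ \oo --> (0 : R).
Proof. by move=> f0; rewrite -[0](mulr0 c); apply: cvgM => //; exact: cvg_cst. Qed.

Lemma qseq_cvg_unique u l l' : qseq_cvg u l -> qseq_cvg u l' -> l = l'.
Proof.
move=> ul ul'; apply/eqP; rewrite -subr_eq0; apply/eqP/qabs_eq0.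
have h : (fun n : nat => qabs (l - l')) @ \oo --> (0 : R).
  apply: squeeze0 (cvg0D ul ul') => n; rewrite qabs_ge0 /=.
  rewrite -(qabsN (u n - l)); apply: le_trans (qabsD _ _).
  by rewrite opprB addrA subrK.
exact: (cvg_unique _ (cvg_cst _) h).
Qed.
Lemma eq_qseq_cvg u v l : qseq_cvg u l -> u =1 v -> qseq_cvg v l.
Proof. by move=> h /funext <-. Qed.
Lemma qseq_cvgD u v l m : qseq_cvg u l -> qseq_cvg v m ->
  qseq_cvg (fun n => u n + v n) (l + m).
Proof.
move=> ul vm; apply: squeeze0 (cvg0D ul vm) => n; rewrite qabs_ge0 /=.
by rewrite opprD addrACA qabsD.
Qed.
Lemma qseq_cvgMr u l q : qseq_cvg u l -> qseq_cvg (fun n => u n * q) (l * q).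
Proof.
move=> ul; apply: squeeze0 (cvg0M (qabs q) ul) => n; rewrite qabs_ge0 /=.
by rewrite -mulrBl qabsM mulrC.
Qed.
Lemma qseq_cvgMl u l q : qseq_cvg u l -> qseq_cvg (fun n => q * u n) (q * l).
Proof.
move=> ul; apply: squeeze0 (cvg0M (qabs q) ul) => n; rewrite qabs_ge0 /=.
by rewrite -mulrBr qabsM.
Qed.
Lemma qseq_cvg_conj u l : qseq_cvg u l ->
  qseq_cvg (fun n => qconj (u n)) (qconj l).
Proof.
move=> ul; apply: squeeze0 ul => n; rewrite qabs_ge0 /=.
by rewrite -[qabs (u n - l)]qabs_conj qconjD qconjN.
Qed.
Lemma qseq_cvg_ge0 u l : qseq_cvg u l ->
  (forall n, 0 <= qre (u n)) -> 0 <= qre l.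
Proof.
move=> ul u0; rewrite leNgt; apply/negP => l0.
have /cvg0P/(_ (- qre l)) := ul; rewrite oppr_gt0 => /(_ l0) [N /(_ N (leqnn N))].
rewrite ger0_norm ?qabs_ge0 // ltNge => /negP; apply.
apply: le_trans (qabs_re _); apply: le_trans (ler_norm _).
by rewrite qreB lerDr.
Qed.
Lemma qseq_cvg_cst q : qseq_cvg (fun=> q) q.
Proof. by apply/cvg0P => e e0; exists 0%N => n _; rewrite subrr qabs0 normr0. Qed.

Lemma real_cauchy (f : nat -> R) :
  (forall e, 0 < e -> exists N,
    forall m n, (N <= m)%N -> (N <= n)%N -> `|f m - f n| < e) ->
  exists l : R, (fun n => `|f n - l|) @ \oo --> (0 : R).
Proof.
move=> h; have /cvg_ex [l fl] : cvgn f.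
  apply/cauchy_cvgP/cauchy_exP => e e0.
  have [N hN] := h e e0; exists (f N); exists N => // n /= Nn.
  by rewrite /ball /=; apply: hN.
exists l; apply/cvg0P => e e0.
have /cvgrPdist_lt/(_ e e0)[N _ hN] := fl; exists N => n /hN.
by rewrite normr_id distrC.
Qed.

Lemma qseq_complete u :
  (forall e : R, 0 < e -> exists N,
    forall m n, (N <= m)%N -> (N <= n)%N -> qabs (u m - u n) < e) ->
  exists l, qseq_cvg u l.
Proof.
move=> h.
have aux (f : quat R -> R) : (forall p q, `|f p - f q| <= qabs (p - q)) ->
    exists l : R, (fun n => `|f (u n) - l|) @ \oo --> (0 : R).
  move=> hf; apply: real_cauchy => e /h [N hN]; exists N => m n Nm Nn.
  exact: le_lt_trans (hf _ _) (hN _ _ Nm Nn).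
have [a ha] := aux _ (fun p q => qabs_re (p - q)).
have [b hb] := aux _ (fun p q => qabs_i (p - q)).
have [c hc] := aux _ (fun p q => qabs_j (p - q)).
have [d hd] := aux _ (fun p q => qabs_k (p - q)).
exists (Quat a b c d).
apply: squeeze0 (cvg0D (cvg0D (cvg0D ha hb) hc) hd) => n.
by rewrite qabs_ge0 /=; exact: qabs_le1.
Qed.

(* A convergent sequence is mapped to its limit, any other to 0. *)
Definition qlim u : quat R := xget 0 [set l | qseq_cvg u l].

Lemma qlimE u l : qseq_cvg u l -> qlim u = l.
Proof. by move=> ul; apply: (qseq_cvg_unique _ ul); apply: (xgetPex 0); exists l. Qed.

End QuatSeq.

(* A Banach generalized limit. The underlying function is total on sequences,
   but it is constrained, and later used, on bounded sequences only. *)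
Record glim (R : realType) := Glim {
  glim_fun :> (nat -> quat R) -> quat R;
  glimD : forall u v, qseq_bounded u -> qseq_bounded v ->
    glim_fun (fun n => u n + v n) = glim_fun u + glim_fun v;
  glimMr : forall u q, qseq_bounded u ->
    glim_fun (fun n => u n * q) = glim_fun u * q;
  glimMl : forall u q, qseq_bounded u ->
    glim_fun (fun n => q * u n) = q * glim_fun u;
  glim_lim : forall u l, qseq_cvg u l -> glim_fun u = l;
  glim_ge0 : forall a : nat -> R, qseq_bounded (fun n => qreal (a n)) ->
    (forall n, 0 <= a n) ->
    exists2 b, 0 <= b & glim_fun (fun n => qreal (a n)) = qreal b
}.

Section GlimTheory.
Variables (R : realType) (L : glim R).
Implicit Types u v : nat -> quat R.

Lemma qseq_boundedD u v : qseq_bounded u -> qseq_bounded v ->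
  qseq_bounded (fun n => u n + v n).
Proof.
move=> [M hM] [N hN]; exists (M + N) => n.
exact: le_trans (qabsD _ _) (lerD (hM n) (hN n)).
Qed.
Lemma qseq_boundedMr u q : qseq_bounded u -> qseq_bounded (fun n => u n * q).
Proof.
by move=> [M hM]; exists (M * qabs q) => n; rewrite qabsM ler_wpM2r ?qabs_ge0.
Qed.

Lemma glim_real (a : nat -> R) : qseq_bounded (fun n => qreal (a n)) ->
  exists b, L (fun n => qreal (a n)) = qreal b.
Proof.
move=> ba; set x := L _.
have C q : x * q = q * x.
  rewrite -glimMr // -glimMl //; congr (L _); apply/funext => n.
  by rewrite qrealC.
exists (qre x); move: (C (Quat 0 1 0 0)) (C (Quat 0 0 1 0)).
case: x {C} => a0 b c d; rewrite /GRing.mul /= => -[_ _ h1 h2] [_ h3 _ h4].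
by apply: quat_eqP => /=; lra.
Qed.

Lemma glim_conj u : qseq_bounded u -> L (fun n => qconj (u n)) = qconj (L u).
Proof.
move=> [M hM].
have bd (f : quat R -> R) : (forall p, `|f p| <= qabs p) ->
    qseq_bounded (fun n => qreal (f (u n))).
  by move=> hf; exists M => n; rewrite qabs_real (le_trans (hf _)).
have [a ha] := glim_real (bd _ (@qabs_re R)).
have [b hb] := glim_real (bd _ (@qabs_i R)).
have [c hc] := glim_real (bd _ (@qabs_j R)).
have [d hd] := glim_real (bd _ (@qabs_k R)).
have E s : L (fun n => qreal (qre (u n)) + qreal (qi (u n)) * Quat 0 s 0 0
      + qreal (qj (u n)) * Quat 0 0 s 0 + qreal (qk (u n)) * Quat 0 0 0 s)
   = Quat a (s * b) (s * c) (s * d).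
  have [ba bb] := (bd _ (@qabs_re R), bd _ (@qabs_i R)).
  have [bc bdd] := (bd _ (@qabs_j R), bd _ (@qabs_k R)).
  have bb' := qseq_boundedMr (Quat 0 s 0 0) bb.
  have bc' := qseq_boundedMr (Quat 0 0 s 0) bc.
  have bd' := qseq_boundedMr (Quat 0 0 0 s) bdd.
  have b1 := qseq_boundedD ba bb'; have b2 := qseq_boundedD b1 bc'.
  rewrite [LHS](glimD L b2 bd') (glimD L b1 bc') (glimD L ba bb').
  rewrite (glimMr L _ bb) (glimMr L _ bc) (glimMr L _ bdd).
  by rewrite ha hb hc hd; apply: quat_eqP => /=; ring.
have <- : L (fun n => qreal (qre (u n)) + qreal (qi (u n)) * Quat 0 (-1) 0 0
      + qreal (qj (u n)) * Quat 0 0 (-1) 0 + qreal (qk (u n)) * Quat 0 0 0 (-1))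
   = L (fun n => qconj (u n)).
  by congr (L _); apply/funext => n; apply: quat_eqP => /=; ring.
have <- : L (fun n => qreal (qre (u n)) + qreal (qi (u n)) * Quat 0 1 0 0
      + qreal (qj (u n)) * Quat 0 0 1 0 + qreal (qk (u n)) * Quat 0 0 0 1)
   = L u.
  by congr (L _); apply/funext => n; apply: quat_eqP => /=; ring.
by rewrite !E; apply: quat_eqP => /=; ring.
Qed.

Lemma glim_le (a b : nat -> R) : qseq_bounded (fun n => qreal (a n)) ->
  qseq_bounded (fun n => qreal (b n)) -> (forall n, a n <= b n) ->
  qre (L (fun n => qreal (a n))) <= qre (L (fun n => qreal (b n))).
Proof.
move=> ba bb ab.
have bc : qseq_bounded (fun n => qreal (b n - a n)).
  have [[M hM] [N hN]] := (ba, bb); exists (N + M) => n.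
  move: (hM n) (hN n); rewrite !qabs_real => ? ?.
  by rewrite (le_trans (ler_normB _ _)) ?lerD.
have [c c0 hc] := glim_ge0 L bc (fun n => etrans (subr_ge0 _ _) (ab n)).
have -> : (fun n => qreal (b n)) = (fun n => qreal (a n) + qreal (b n - a n)).
  by apply/funext => n; rewrite -qrealD addrC subrK.
by rewrite glimD // hc qreD lerDl.
Qed.
End GlimTheory.

Section BoundedSeq.
Variables (R : realType) (V : qPreHilbertType R).

Definition bounded_pred : {pred nat -> V} :=
  fun s => `[< exists M, forall n, qnorm (s n) <= M >].

Fact bounded_submod_closed : submod_closed bounded_pred.
Proof.
split=> [|q s t /asboolP [M hM] /asboolP [N hN]]; apply/asboolP.
  by exists 0 => n; rewrite qnorm0.
exists (M * qabs q + N) => n; apply: le_trans (qnormD _ _) _.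
by rewrite lerD // qnormZ ler_wpM2r ?qabs_ge0.
Qed.
HB.instance Definition _ := GRing.isSubmodClosed.Build (quat R)^c (nat -> V)
  bounded_pred bounded_submod_closed.

End BoundedSeq.

(* The bounded sequences in V. The parameter L does not constrain them: it
   determines the semi-inner product with which this type is equipped. *)
Record qbseq (R : realType) (L : glim R) (V : qPreHilbertType R) := QBSeq {
  qbseq_val :> nat -> V; qbseqP : qbseq_val \in @bounded_pred R V }.

Section BoundedSeqSpace.
Variables (R : realType) (L : glim R) (V : qPreHilbertType R).
Local Notation B := (qbseq L V).

HB.instance Definition _ := [isSub for @qbseq_val R L V].
HB.instance Definition _ := [Choice of B by <:].
HB.instance Definition _ := [SubChoice_isSubLmodule of B by <:].

Implicit Types s t : B.

Lemma qbseq_bound s : exists2 M, 0 <= M & forall n, qnorm (s n) <= M.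
Proof.
have /asboolP [M hM] := qbseqP s; exists M => //.
exact: le_trans (qnorm_ge0 _) (hM 0%N).
Qed.
Lemma qbseqD s t n : (s + t) n = s n + t n. Proof. by []. Qed.
Lemma qbseqZ (q : (quat R)^c) s n : (q *: s) n = q *: s n. Proof. by []. Qed.

Lemma qbseq_dot_bounded s t : qseq_bounded (fun n => qdot (s n) (t n)).
Proof.
have [[M M0 hM] [N N0 hN]] := (qbseq_bound s, qbseq_bound t).
exists (M * N) => n; apply: le_trans (qdot_le _ _) _.
by rewrite ler_pM ?qnorm_ge0.
Qed.

(* Phi(s, t) = glim <s_n | t_n> *)
Definition qbseq_dot s t : quat R := L (fun n => qdot (s n) (t n)).

Fact qbseq_dotDl s t w : qbseq_dot (s + t) w = qbseq_dot s w + qbseq_dot t w.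
Proof.
rewrite -glimD; do ?exact: qbseq_dot_bounded.
by congr (L _); apply/funext => n; rewrite -qdotDl.
Qed.
Fact qbseq_dotDr s t w : qbseq_dot s (t + w) = qbseq_dot s t + qbseq_dot s w.
Proof.
rewrite -glimD; do ?exact: qbseq_dot_bounded.
by congr (L _); apply/funext => n; rewrite -qdotDr.
Qed.
Fact qbseq_dotC s t : qconj (qbseq_dot s t) = qbseq_dot t s.
Proof.
rewrite -glim_conj; last exact: qbseq_dot_bounded.
by congr (L _); apply/funext => n; rewrite qdotC.
Qed.
Fact qbseq_dotZr s t (q : quat R) : qbseq_dot s (t *> q) = qbseq_dot s t * q.
Proof.
rewrite -glimMr; last exact: qbseq_dot_bounded.
by congr (L _); apply/funext => n; rewrite -qdotZr.
Qed.
Fact qbseq_dotZl s t (q : quat R) : qbseq_dot (s *> q) t = qconj q * qbseq_dot s t.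
Proof.
rewrite -glimMl; last exact: qbseq_dot_bounded.
by congr (L _); apply/funext => n; rewrite -qdotZl.
Qed.
Lemma qbseq_norm_bounded s : qseq_bounded (fun n => qreal (qnorm (s n) ^+ 2)).
Proof.
have [M hM] := qbseq_dot_bounded s s; exists M => n; have := hM n.
by rewrite qdot_norm.
Qed.
Lemma qbseq_dot_norm s : qbseq_dot s s = L (fun n => qreal (qnorm (s n) ^+ 2)).
Proof. by congr (L _); apply/funext => n; rewrite qdot_norm. Qed.
Fact qbseq_dot_ge0 s : 0 <= qre (qbseq_dot s s).
Proof.
have [b b0] := glim_ge0 L (qbseq_norm_bounded s) (fun n => sqr_ge0 _).
by rewrite qbseq_dot_norm => ->.
Qed.
HB.instance Definition _ := isQSemiInner.Build R B
  qbseq_dotDl qbseq_dotDr qbseq_dotC qbseq_dotZr qbseq_dotZl qbseq_dot_ge0.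

Lemma qdot_qbseqE s t : qdot s t = L (fun n => qdot (s n) (t n)).
Proof. by []. Qed.
Lemma qbseq_norm_sqr s :
  qnorm s ^+ 2 = qre (L (fun n => qreal (qnorm (s n) ^+ 2))).
Proof. by rewrite -qbseq_dot_norm qnorm_sqr. Qed.
End BoundedSeqSpace.

Section CauchySeq.
Variables (R : realType) (V : qPreHilbertType R).

Definition cauchy_pred : {pred nat -> V} := fun s => `[< qcauchy s >].

Fact cauchy_submod_closed : submod_closed cauchy_pred.
Proof.
split=> [|q s t /asboolP cs /asboolP ct]; apply/asboolP => e e0.
  by exists 0%N => m n _ _; rewrite subrr qnorm0.
have d0 : 0 < e / 2 / (qabs q + 1).
  by rewrite !divr_gt0 // ltr_wpDl ?qabs_ge0.
have [[M hM] [N hN]] := (cs _ d0, ct _ (divr_gt0 e0 (ltr0n _ 2))).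
exists (maxn M N) => m n; rewrite !geq_max => /andP[Mm Nm] /andP[Mn Nn].
rewrite /= opprD addrACA -scalerBr; apply: le_lt_trans (qnormD _ _) _.
rewrite qnormZ [ltRHS]splitr ltrD ?hN //.
apply: (@le_lt_trans _ _ (qnorm (s m - s n) * (qabs q + 1))).
  by rewrite ler_wpM2l ?qnorm_ge0 // lerDl.
by rewrite -ltr_pdivlMr ?ltr_wpDl ?qabs_ge0 ?hM.
Qed.
HB.instance Definition _ := GRing.isSubmodClosed.Build (quat R)^c (nat -> V)
  cauchy_pred cauchy_submod_closed.

Record qcseq := QCSeq { qcseq_val :> nat -> V; qcseqP : qcseq_val \in cauchy_pred }.
HB.instance Definition _ := [isSub for qcseq_val].
HB.instance Definition _ := [Choice of qcseq by <:].
HB.instance Definition _ := [SubChoice_isSubLmodule of qcseq by <:].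

Implicit Types s t : qcseq.

Lemma qcseq_cauchy s : qcauchy s. Proof. exact/asboolP/qcseqP. Qed.

Lemma qcauchy_bound (s : nat -> V) : qcauchy s ->
  exists2 M, 0 < M & forall n, qnorm (s n) <= M.
Proof.
move=> /(_ 1 ltr01) [N hN].
exists (1 + qnorm (s N) + \sum_(i < N) qnorm (s i)).
  by rewrite -addrA ltr_pwDl // addr_ge0 ?sumr_ge0 ?qnorm_ge0 // => i _; exact: qnorm_ge0.
move=> n; case: (leqP N n) => [Nn|nN].
  apply: (@le_trans _ _ (1 + qnorm (s N))); last first.
    by rewrite lerDl sumr_ge0 // => i _; exact: qnorm_ge0.
  have := hN _ _ Nn (leqnn N); have := qnormD (s n - s N) (s N); rewrite subrK; lra.
rewrite (bigD1 (Ordinal nN)) //= [leRHS]addrCA lerDl !addr_ge0 ?qnorm_ge0 //.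
by apply: sumr_ge0 => i _; exact: qnorm_ge0.
Qed.

Lemma qdot_cauchy_cvg s t : exists l, qseq_cvg (fun n => qdot (s n) (t n)) l.
Proof.
apply: qseq_complete => e e0.
have [M M0 hM] := qcauchy_bound (qcseq_cauchy s).
have [N N0 hN] := qcauchy_bound (qcseq_cauchy t).
have dN : 0 < e / 2 / N by rewrite !divr_gt0.
have dM : 0 < e / 2 / M by rewrite !divr_gt0.
have [[a ha] [b hb]] := (qcseq_cauchy s dN, qcseq_cauchy t dM).
exists (maxn a b) => m n; rewrite !geq_max => /andP[am bm] /andP[an bn].
have -> : qdot (s m) (t m) - qdot (s n) (t n)
        = qdot (s m - s n) (t m) + qdot (s n) (t m - t n).
  by rewrite qdotBl qdotBr addrA subrK.
apply: le_lt_trans (qabsD _ _) _; rewrite [ltRHS]splitr.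
apply: ltrD; apply: le_lt_trans (qdot_le _ _) _.
  apply: (@le_lt_trans _ _ (qnorm (s m - s n) * N)).
    by rewrite ler_wpM2l ?qnorm_ge0.
  by rewrite -ltr_pdivlMr // ha.
apply: (@le_lt_trans _ _ (M * qnorm (t m - t n))).
  by rewrite ler_wpM2r ?qnorm_ge0.
by rewrite mulrC -ltr_pdivlMr // hb.
Qed.

Definition qcseq_dot s t : quat R := qlim (fun n => qdot (s n) (t n)).

Lemma qcseq_dot_cvg s t : qseq_cvg (fun n => qdot (s n) (t n)) (qcseq_dot s t).
Proof. by have [l hl] := qdot_cauchy_cvg s t; rewrite /qcseq_dot (qlimE hl). Qed.

Fact qcseq_dotDl s t w : qcseq_dot (s + t) w = qcseq_dot s w + qcseq_dot t w.
Proof.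
apply: qlimE.
apply: (eq_qseq_cvg (qseq_cvgD (qcseq_dot_cvg s w) (qcseq_dot_cvg t w))) => n.
by rewrite -qdotDl.
Qed.
Fact qcseq_dotDr s t w : qcseq_dot s (t + w) = qcseq_dot s t + qcseq_dot s w.
Proof.
apply: qlimE.
apply: (eq_qseq_cvg (qseq_cvgD (qcseq_dot_cvg s t) (qcseq_dot_cvg s w))) => n.
by rewrite -qdotDr.
Qed.
Fact qcseq_dotC s t : qconj (qcseq_dot s t) = qcseq_dot t s.
Proof.
apply/esym/qlimE; apply: (eq_qseq_cvg (qseq_cvg_conj (qcseq_dot_cvg s t))) => n.
by rewrite qdotC.
Qed.
Fact qcseq_dotZr s t (q : quat R) : qcseq_dot s (t *> q) = qcseq_dot s t * q.
Proof.
apply: qlimE.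
apply: (eq_qseq_cvg (qseq_cvgMr q (qcseq_dot_cvg s t))) => n.
by rewrite -qdotZr.
Qed.
Fact qcseq_dotZl s t (q : quat R) : qcseq_dot (s *> q) t = qconj q * qcseq_dot s t.
Proof.
apply: qlimE.
apply: (eq_qseq_cvg (qseq_cvgMl (qconj q) (qcseq_dot_cvg s t))) => n.
by rewrite -qdotZl.
Qed.
Fact qcseq_dot_ge0 s : 0 <= qre (qcseq_dot s s).
Proof. by apply: qseq_cvg_ge0 (qcseq_dot_cvg s s) _ => n; exact: qdot_ge0. Qed.
HB.instance Definition _ := isQSemiInner.Build R qcseq
  qcseq_dotDl qcseq_dotDr qcseq_dotC qcseq_dotZr qcseq_dotZl qcseq_dot_ge0.

Lemma qdot_qcseqE s t : qdot s t = qlim (fun n => qdot (s n) (t n)).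
Proof. by []. Qed.

Lemma qcseq_norm_le s e : (exists N, forall n, (N <= n)%N -> qnorm (s n) <= e) ->
  qnorm s <= e.
Proof.
move=> [N hN].
have e0 : 0 <= e := le_trans (qnorm_ge0 _) (hN N (leqnn N)).
apply: ler_sqrP => //; rewrite leNgt; apply/negP => lt.
have := qcseq_dot_cvg s s => /cvg0P; rewrite qnorm_sqr -subr_gt0 in lt.
move=> /(_ _ lt) [M hM].
have := hM (maxn M N) (leq_maxl _ _); rewrite ger0_norm ?qabs_ge0 //.
apply/negP; rewrite -leNgt -qabsN opprB.
apply: le_trans (qabs_re _); apply: le_trans (ler_norm _).
rewrite qreB lerB // -qnorm_sqr lerXn2r ?nnegrE ?qnorm_ge0 //.
by rewrite hN ?leq_maxr.
Qed.
End CauchySeq.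

(* The Hilbert space completion: Cauchy sequences modulo null sequences. *)
Section Completion.
Variables (R : realType) (V : qPreHilbertType R).

Definition qcompletion : Type := qquot (qcseq V).
HB.instance Definition _ := QPreHilbert.on qcompletion.

Fact qcauchy_cst (v : V) : (fun=> v) \in @cauchy_pred R V.
Proof.
by apply/asboolP => e e0; exists 0%N => m n _ _; rewrite subrr qnorm0.
Qed.

Definition qembed (v : V) : qcompletion := qclass (QCSeq (qcauchy_cst v)).

Fact qembed_linear : linear qembed.
Proof.
move=> q u v; rewrite /qembed -qclassZ -qclassD; congr qclass.
exact: val_inj.
Qed.
HB.instance Definition _ :=
  GRing.isLinear.Build (quat R)^c V qcompletion *:%R qembed qembed_linear.

Lemma qnorm_class (W : qSemiType R) (w : W) : qnorm (qclass w) = qnorm w.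
Proof. by rewrite /qnorm qdot_class. Qed.

Lemma qdot_embed (u v : V) : qdot (qembed u) (qembed v) = qdot u v.
Proof. by rewrite qdot_class qdot_qcseqE /= (qlimE (qseq_cvg_cst _)). Qed.

Lemma qnorm_embed (v : V) : qnorm (qembed v) = qnorm v.
Proof. by rewrite /qnorm qdot_embed. Qed.

Lemma qembed_cvg (s : qcseq V) (e : R) : 0 < e ->
  exists N, forall n, (N <= n)%N ->
    qnorm (qembed (s n) - qclass s : qcompletion) <= e.
Proof.
move=> e0; have [N hN] := qcseq_cauchy s e0; exists N => n Nn.
rewrite -qclassB qnorm_class; apply: qcseq_norm_le; exists N => m Nm.
exact/ltW/hN.
Qed.

Lemma qembed_dense (x : qcompletion) (e : R) : 0 < e ->
  exists v : V, qnorm (x - qembed v) <= e.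
Proof.
move=> e0; rewrite -[x]qclassK; have [N hN] := qembed_cvg (repr x) e0.
by exists (repr x N); rewrite qnormBC hN.
Qed.

Lemma qnorm_chain (W : qSemiType R) (x y a b : W) (e : R) :
  qnorm (x - y) < e / 3 -> qnorm (x - a) < e / 3 -> qnorm (y - b) < e / 3 ->
  qnorm (a - b) < e.
Proof.
have -> : a - b = (x - y) - (x - a) + (y - b).
  by rewrite opprB [x - y + _]addrC !subrKA.
have := qnormD ((x - y) - (x - a)) (y - b).
by have := qnormB (x - y) (x - a); lra.
Qed.
Lemma qnorm_mid (W : qSemiType R) (x y z : W) (e : R) :
  qnorm (x - y) < e / 2 -> qnorm (y - z) <= e / 2 -> qnorm (x - z) < e.
Proof. by have := qnormD (x - y) (y - z); rewrite subrKA; lra. Qed.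

Fact qcompletion_complete (X : nat -> qcompletion) :
  qcauchy X -> exists l, qcvg X l.
Proof.
move=> cX.
have h n : {v : V | qnorm (X n - qembed v) <= n.+1%:R^-1}.
  by apply/cid/qembed_dense; rewrite invr_gt0.
pose p n := sval (h n); have hp n : qnorm (X n - qembed (p n)) <= n.+1%:R^-1.
  exact: svalP (h n).
have h0 (e : R) : 0 < e -> exists N, forall n, (N <= n)%N -> n.+1%:R^-1 < e.
  move=> e0; have /cvg0P/(_ e e0)[N hN] := @cvg_harmonic R; exists N => n /hN.
  by rewrite ger0_norm //= invr_ge0.
have cp : qcauchy p.
  move=> e e0; have e3 : 0 < e / 3 by rewrite divr_gt0.
  have [[N hN] [M hM]] := (h0 _ e3, cX _ e3).
  exists (maxn M N) => m n; rewrite !geq_max => /andP[Mm Nm] /andP[Mn Nn].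
  rewrite -qnorm_embed raddfB /=.
  exact: qnorm_chain (hM _ _ Mm Mn) (le_lt_trans (hp m) (hN _ Nm))
    (le_lt_trans (hp n) (hN _ Nn)).
pose s := QCSeq (asboolT cp : p \in @cauchy_pred R V).
exists (qclass s); apply/cvg0P => e e0; have e2 : 0 < e / 2 by rewrite divr_gt0.
have [[N hN] [M hM]] := (h0 _ e2, qembed_cvg s e2).
exists (maxn M N) => n; rewrite geq_max => /andP[Mn Nn].
rewrite ger0_norm ?qnorm_ge0 //.
exact: qnorm_mid (le_lt_trans (hp n) (hN _ Nn)) (hM _ Mn).
Qed.
HB.instance Definition _ := isQComplete.Build R qcompletion qcompletion_complete.
End Completion.

(* Bounded everywhere-defined right linear operators. *)
Definition qbounded_op (R : realType) (W : qSemiType R) (A : W -> W) :=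
  exists M, forall v, qnorm (A v) <= M * qnorm v.

Record bop (R : realType) (W : qSemiType R) := BOp {
  bop_fun :> {linear W -> W};
  bopP : qbounded_op bop_fun }.

Section Operators.
Variable R : realType.

Lemma bop_bound (W : qSemiType R) (A : bop W) :
  exists2 M, 0 <= M & forall v, qnorm (A v) <= M * qnorm v.
Proof.
have [M hM] := bopP A; exists `|M| => // v; apply: le_trans (hM v) _.
by rewrite ler_wpM2r ?qnorm_ge0 // ler_norm.
Qed.

Section Quotient.
Variables (W : qSemiType R) (A : bop W).

Definition qquot_fun (x : qquot W) : qquot W := qclass (A (repr x)).

Lemma qquot_funE w : qquot_fun (qclass w) = qclass (A w).
Proof.
apply/qclassP; rewrite -raddfB /=; apply/qnullP/eqP.
rewrite eq_le qnorm_ge0 andbT; have [M _ /(_ (repr (qclass w) - w))] := bop_bound A.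
by have /qnullP -> := qclass_repr w; rewrite mulr0.
Qed.
Fact qquot_fun_linear : linear qquot_fun.
Proof.
move=> q x y; rewrite -[x]qclassK -[y]qclassK -qclassZ -qclassD !qquot_funE.
by rewrite linearP qclassD qclassZ.
Qed.
HB.instance Definition _ := GRing.isLinear.Build (quat R)^c (qquot W) (qquot W)
  *:%R qquot_fun qquot_fun_linear.
Fact qquot_fun_bounded : qbounded_op qquot_fun.
Proof.
have [M hM] := bopP A; exists M => x.
by rewrite -[x]qclassK qquot_funE !qnorm_class.
Qed.
Definition qquot_op : bop (qquot W) := BOp qquot_fun_bounded.
End Quotient.

Section TermwiseBounded.
Variables (L : glim R) (V : qPreHilbertType R) (A : bop V).

Fact qbseq_fun_subproof (s : qbseq L V) : (A \o s) \in @bounded_pred R V.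
Proof.
have [[M M0 hM] [N N0 hN]] := (bop_bound A, qbseq_bound s).
apply/asboolP; exists (M * N) => n; apply: le_trans (hM _) _.
by rewrite ler_wpM2l.
Qed.
Definition qbseq_fun (s : qbseq L V) : qbseq L V := QBSeq L (qbseq_fun_subproof s).
Fact qbseq_fun_linear : linear qbseq_fun.
Proof. by move=> q s t; apply/val_inj/funext => n /=; exact: linearP. Qed.
HB.instance Definition _ := GRing.isLinear.Build (quat R)^c (qbseq L V) (qbseq L V)
  *:%R qbseq_fun qbseq_fun_linear.
Fact qbseq_fun_bounded : qbounded_op qbseq_fun.
Proof.
have [M M0 hM] := bop_bound A; exists M => s.
apply: ler_sqrP; first by rewrite mulr_ge0 ?qnorm_ge0.
rewrite exprMn !qbseq_norm_sqr.
have -> : M ^+ 2 * qre (L (fun n => qreal (qnorm (s n) ^+ 2)))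
   = qre (L (fun n => qreal (M ^+ 2 * qnorm (s n) ^+ 2))).
  have -> : (fun n => qreal (M ^+ 2 * qnorm (s n) ^+ 2)) =
            (fun n => qreal (M ^+ 2) * qreal (qnorm (s n) ^+ 2)).
    by apply/funext => n; rewrite qrealM.
  rewrite glimMl; last exact: qbseq_norm_bounded.
  by rewrite /= !mul0r !subr0.
apply: glim_le => [||n]; first exact: qbseq_norm_bounded (qbseq_fun s).
  have [N hN] := qbseq_norm_bounded s; exists (qabs (qreal (M ^+ 2)) * N) => n.
  by rewrite qrealM qabsM ler_wpM2l ?qabs_ge0.
by rewrite -exprMn lerXn2r ?nnegrE ?mulr_ge0 ?qnorm_ge0 //=.
Qed.
Definition qbseq_op : bop (qbseq L V) := BOp qbseq_fun_bounded.
End TermwiseBounded.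

Section TermwiseCauchy.
Variables (V : qPreHilbertType R) (A : bop V).

Fact qcseq_fun_subproof (s : qcseq V) : (A \o s) \in @cauchy_pred R V.
Proof.
have [M M0 hM] := bop_bound A; apply/asboolP => e e0.
have M1 : 0 < M + 1 by rewrite ltr_wpDl.
have [N hN] := qcseq_cauchy s (divr_gt0 e0 M1); exists N => m n Nm Nn /=.
rewrite -raddfB; apply: le_lt_trans (hM _) _.
apply: (@le_lt_trans _ _ (qnorm (s m - s n) * (M + 1))).
  by rewrite mulrC ler_wpM2l ?qnorm_ge0 // lerDl.
by rewrite -ltr_pdivlMr // hN.
Qed.
Definition qcseq_fun (s : qcseq V) : qcseq V := QCSeq (qcseq_fun_subproof s).
Fact qcseq_fun_linear : linear qcseq_fun.
Proof. by move=> q s t; apply/val_inj/funext => n /=; exact: linearP. Qed.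
HB.instance Definition _ := GRing.isLinear.Build (quat R)^c (qcseq V) (qcseq V)
  *:%R qcseq_fun qcseq_fun_linear.
Fact qcseq_fun_bounded : qbounded_op qcseq_fun.
Proof.
have [M M0 hM] := bop_bound A; exists M => s.
apply/ler_addgt0Pr => e e0.
have M1 : 0 < M + 1 by rewrite ltr_wpDl.
have [N hN] := qembed_cvg s (divr_gt0 e0 M1).
apply: qcseq_norm_le; exists N => n /hN h /=; apply: le_trans (hM _) _.
have := qnormD (qembed (s n) - qclass s) (qclass s); rewrite subrK.
rewrite qnorm_embed [qnorm (qclass s)]qnorm_class => h'.
have {}h := le_trans h' (lerD h (lexx _)).
apply: le_trans (ler_wpM2l M0 h) _; rewrite mulrDr addrC lerD2l.
rewrite mulrCA -{2}[e]mulr1 ler_pM2l // ler_pdivrMr // mul1r lerDl //.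
Qed.
Definition qcseq_op : bop (qcseq V) := BOp qcseq_fun_bounded.
End TermwiseCauchy.
End Operators.

Section Berberian.
Variables (R : realType) (L : glim R) (V : qPreHilbertType R).

(* Bounded sequences modulo the null vectors of [qbseq_dot]. *)
Definition berberian_pre : Type := qquot (qbseq L V).
HB.instance Definition _ := QPreHilbert.on berberian_pre.

Definition berberian : Type := qcompletion berberian_pre.
HB.instance Definition _ := QHilbert.on berberian.

(* The operator class of s |-> class of A \o s, see [berberian_pre_opE]. *)
Definition berberian_pre_op (A : bop V) : bop berberian_pre :=
  qquot_op (qbseq_op L A).

(* The extension by continuity of [berberian_pre_op A]: the class of a Cauchy
   sequence is mapped to the class of its termwise image. Lemmas
   [berberian_opE] and [berberian_op_unique] below show that it is the only
   bounded extension. *)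
Definition berberian_op (A : bop V) : bop berberian :=
  qquot_op (qcseq_op (berberian_pre_op A)).

Lemma berberian_pre_opE (A : bop V) (s : qbseq L V) :
  berberian_pre_op A (qclass s) = qclass (qbseq_fun A s).
Proof. exact: (qquot_funE (qbseq_op L A)). Qed.

Lemma berberian_opE (A : bop V) (x : berberian_pre) :
  berberian_op A (qembed x) = qembed (berberian_pre_op A x).
Proof.
rewrite [LHS](qquot_funE (qcseq_op (berberian_pre_op A))).
by congr qclass; exact: val_inj.
Qed.

Lemma berberian_op_unique (A : bop V) (T : bop berberian) :
  (forall x, T (qembed x) = qembed (berberian_pre_op A x)) ->
  forall y, T y = berberian_op A y.
Proof.
move=> hT y; apply/eqP; rewrite -subr_eq0; apply/negPn/negP => /qdot_gt0.
have [[M M0 hM] [N N0 hN]] := (bop_bound T, bop_bound (berberian_op A)).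
rewrite lt_neqAle => /andP[/eqP + _]; apply; rewrite -qnorm_sqr.
apply/esym/eqP; rewrite sqrf_eq0 eq_le qnorm_ge0 andbT.
apply/ler_addgt0Pr => e e0; rewrite add0r.
have MN : 0 < M + N + 1 by rewrite ltr_wpDl // addr_ge0.
have [x hx] := qembed_dense y (divr_gt0 e0 MN).
have -> : T y - berberian_op A y =
    T (y - qembed x) - berberian_op A (y - qembed x).
  rewrite [T (_ - _)]raddfB [berberian_op A (_ - _)]raddfB /=.
  by rewrite hT berberian_opE opprB addrA subrK.
apply: le_trans (qnormB _ _) _.
apply: le_trans (lerD (hM _) (hN _)) _; rewrite -mulrDl.
apply: (@le_trans _ _ ((M + N + 1) * qnorm (y - qembed x : berberian))).
  by rewrite ler_wpM2r ?qnorm_ge0 // lerDl.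
by rewrite mulrC -ler_pdivlMr.
Qed.
End Berberian.

Section Spectra.
Variables (R : realType) (W : qHilbertType R) (A : bop W).

(* R_q(A) = A^2 - 2 Re(q) A + |q|^2; the coefficients are real, so they commute
   with all quaternions and scaling by them is unambiguous. *)
Definition qpoly_op (q : quat R) (v : W) : W :=
  A (A v) - A v *> qreal (2 * qre q) + v *> qreal (qabs q ^+ 2).

Definition point_Sspectrum : set (quat R) :=
  [set q | [set v | qpoly_op q v = 0] <> [set 0]].

Definition approx_Sspectrum : set (quat R) :=
  [set q | exists phi : nat -> W, (forall n, qnorm (phi n) = 1) /\
     (fun n => qnorm (qpoly_op q (phi n))) @ \oo --> (0 : R)].
End Spectra.

Definition qseparable (R : realType) (V : qPreHilbertType R) :=
  exists2 D : set V, countable D &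
    forall (v : V) (e : R), 0 < e -> exists2 d, D d & qnorm (v - d) < e.

(* Main.v *)
(** Write [T = R_q(A)]. The extension [A |-> A°] is compatible with polynomials
    with real coefficients, so [R_q(A°) = T°]. A sequence of unit vectors with
    [T phi_n --> 0] defines a unit vector of the Berberian space killed by [T°].
    Conversely, if no such sequence exists then [T] is bounded below; a lower
    bound survives the generalized limit, because glim is monotone, and then the
    completion, by density, so that [T°] has no approximate kernel either. *)
From HB Require Import structures.
Require Import Defs.
From mathcomp Require Import all_boot all_order all_algebra.
From mathcomp Require Import all_classical all_reals all_analysis.
From mathcomp Require Import lra.

Set Implicit Arguments.
Unset Strict Implicit.
Unset Printing Implicit Defensive.
Import Order.TTheory GRing.Theory Num.Theory.
Import numFieldNormedType.Exports.

Local Open Scope classical_set_scope.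
Local Open Scope ring_scope.

Section QuadraticOperator.
Variables (R : realType) (W : qSemiType R) (A : bop W) (q : quat R).

(** Same formula as [qpoly_op], but over a semi-inner product space: it then makes sense on
    [berberian_pre], which need not be complete, and the bundled [quadratic_op] has itself a
    Berberian extension. *)
Definition quadratic_fun (v : W) : W :=
  A (A v) - A v *> qreal (2 * qre q) + v *> qreal (qabs q ^+ 2).

Fact quadratic_fun_linear : linear quadratic_fun.
Proof.
move=> a u v; rewrite /quadratic_fun !linearP !scalerDr scalerN !scalerA.
(* Real quaternions are central, hence right linearity survives scaling by the coefficients. *)
have C (r : R) : (qreal r : (quat R)^c) * a = a * qreal r.
  exact/esym/(qrealC r a).
by rewrite !C opprD [X in X + _ = _]addrACA [LHS]addrACA.
Qed.
HB.instance Definition _ := GRing.isLinear.Build (quat R)^c W W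
  *:%R quadratic_fun quadratic_fun_linear.

Fact quadratic_fun_bounded : qbounded_op quadratic_fun.
Proof.
have [M M0 hM] := bop_bound A.
exists (M * M + M * qabs (qreal (2 * qre q)) + qabs (qreal (qabs q ^+ 2))) => v.
apply: le_trans (qnormD _ _) _; rewrite !mulrDl; apply: lerD; last first.
  by rewrite qnormZ mulrC.
apply: le_trans (qnormB _ _) _; apply: lerD.
  by rewrite -mulrA; apply: le_trans (hM _) (ler_wpM2l M0 (hM v)).
by rewrite qnormZ mulrAC ler_wpM2r ?qabs_ge0.
Qed.
Definition quadratic_op : bop W := BOp quadratic_fun_bounded.
End QuadraticOperator.

Section Berberian.
Variables (R : realType) (L : glim R) (V : qPreHilbertType R).
Implicit Types (A T : bop V).

Lemma qnorm_berberian_opE T (s : qbseq L V) :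
  qnorm (berberian_op L T (qembed (qclass s))) = qnorm (qbseq_fun T s).
Proof. by rewrite berberian_opE qnorm_embed berberian_pre_opE qnorm_class. Qed.

(** A bounded extension is unique, so it suffices to compare on embedded classes, where both sides
    act termwise on a representative sequence. *)
Lemma berberian_quadratic A q y :
  berberian_op L (quadratic_op A q) y = quadratic_op (berberian_op L A) q y.
Proof.
apply/esym/berberian_op_unique => x /=.
have -> : berberian_pre_op L (quadratic_op A q) x =
    quadratic_fun (berberian_pre_op L A) q x.
  rewrite -[x]qclassK; move: (repr x) => s; rewrite /quadratic_fun.
  rewrite (berberian_pre_opE A s) !berberian_pre_opE -!qclassZ -qclassB.
  by rewrite -qclassD; congr qclass; exact: val_inj.
have qembedZ (a : (quat R)^c) (u : berberian_pre L V) :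
    qembed (a *: u) = a *: qembed u by exact: linearZ.
by rewrite /quadratic_fun !berberian_opE raddfD raddfB /= !qembedZ.
Qed.

(** Squared norms are generalized limits of squared norms, so the termwise inequality passes through
    [glim_le] once [c ^+ 2] is moved inside the limit. *)
Lemma qbseq_bounded_below T (c : R) : 0 <= c ->
  (forall v, c * qnorm v <= qnorm (T v)) ->
  forall s : qbseq L V, c * qnorm s <= qnorm (qbseq_fun T s).
Proof.
move=> c0 hc s; apply: ler_sqrP; first exact: qnorm_ge0.
rewrite exprMn !qbseq_norm_sqr.
have E : (fun n => qreal (c ^+ 2 * qnorm (s n) ^+ 2)) =
         (fun n => qreal (c ^+ 2) * qreal (qnorm (s n) ^+ 2)).
  by apply/funext => n; rewrite qrealM.
have [N hN] := qbseq_norm_bounded s.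
have -> : c ^+ 2 * qre (L (fun n => qreal (qnorm (s n) ^+ 2))) =
          qre (L (fun n => qreal (c ^+ 2 * qnorm (s n) ^+ 2))).
  by rewrite E glimMl /= ?mul0r ?subr0 //; exists N.
apply: glim_le => [||n]; last 1 first.
- by rewrite -exprMn lerXn2r ?nnegrE ?mulr_ge0 ?qnorm_ge0.
- exists (qabs (qreal (c ^+ 2)) * N) => n.
  by rewrite qrealM qabsM ler_wpM2l ?qabs_ge0.
- exact: qbseq_norm_bounded (qbseq_fun T s).
Qed.

Lemma berberian_bounded_below T (c : R) : 0 <= c ->
  (forall v, c * qnorm v <= qnorm (T v)) ->
  forall y : berberian L V, c * qnorm y <= qnorm (berberian_op L T y).
Proof.
move=> c0 hc y; have [M M0 hM] := bop_bound (berberian_op L T).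
(* Replacing [y] by an embedded vector at distance d costs at most c d + M d; the extra 1 keeps the
   divisor positive when [M] and [c] vanish. *)
have Mc : 0 < M + c + 1 by rewrite ltr_wpDl ?addr_ge0.
apply/ler_addgt0Pr => e e0.
have [x hx] := qembed_dense y (divr_gt0 e0 Mc).
rewrite ler_pdivlMr // in hx.
have hcx : c * qnorm (qembed x) <= qnorm (berberian_op L T (qembed x)).
  rewrite -[x]qclassK qnorm_embed qnorm_class qnorm_berberian_opE.
  exact: qbseq_bounded_below.
have h1 := qnormD (y - qembed x) (qembed x); rewrite subrK in h1.
have h2 := qnormD (berberian_op L T (qembed x - y)) (berberian_op L T y).
rewrite -raddfD subrK in h2.
have h3 := hM (qembed x - y); rewrite qnormBC in h3.
have h4 := ler_wpM2l c0 h1.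
move: (qnorm_ge0 (y - qembed x)) hx hcx h1 h2 h3 h4.
move: (qnorm (y - qembed x)) (qnorm (qembed x)) (qnorm y).
move: (qnorm (berberian_op L T (qembed x))) (qnorm (berberian_op L T y)).
move: (qnorm (berberian_op L T (qembed x - y))) => {x y T hc hM} *.
lra.
Qed.

(** The class of [phi] itself is the kernel vector: its squared norm is the glim of the constant 1,
    and that of its image is the glim of a null sequence. *)
Lemma berberian_kernel T (phi : nat -> V) : (forall n, qnorm (phi n) = 1) ->
  (fun n => qnorm (T (phi n))) @ \oo --> (0 : R) ->
  exists2 y : berberian L V, qnorm y = 1 & berberian_op L T y = 0.
Proof.
move=> phi1 Tphi.
have phiB : phi \in @bounded_pred R V.
  by apply/asboolP; exists 1 => n; rewrite phi1.
pose s := QBSeq L phiB; exists (qembed (qclass s)).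
  rewrite qnorm_embed qnorm_class /qnorm -qnorm_sqr qbseq_norm_sqr.
  rewrite (@glim_lim _ L _ (qreal 1)) ?sqrtr1 //.
  apply: eq_qseq_cvg (qseq_cvg_cst _) _ => n /=.
  by rewrite phi1 expr1n.
(* By definiteness, a nonzero image would have a positive squared norm. *)
apply/eqP/negPn/negP => /qdot_gt0; rewrite -qnorm_sqr qnorm_berberian_opE.
rewrite qbseq_norm_sqr (@glim_lim _ L _ 0) ?qre0 ?ltxx //.
have h : (fun n => qnorm (T (phi n)) ^+ 2) @ \oo --> (0 : R).
  by rewrite -[0](mulr0 0); exact: cvgM.
apply: squeeze0 h => n; rewrite qabs_ge0 /= subr0 qabs_real.
by rewrite ger0_norm ?sqr_ge0.
Qed.
End Berberian.

Section Spectra.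
Variables (R : realType) (W : qHilbertType R) (A : bop W) (q : quat R).

Lemma qpoly_opE v : qpoly_op A q v = quadratic_op A q v.
Proof. by []. Qed.

Lemma qnorm_gt0 (v : W) : v != 0 -> 0 < qnorm v.
Proof. by move=> v0; rewrite sqrtr_gt0 qdot_gt0. Qed.

Lemma qnorm_normalize (v : W) : v != 0 -> qnorm (v *> qreal (qnorm v)^-1) = 1.
Proof.
move=> /qnorm_gt0 v0.
by rewrite qnormZ qabs_real ger0_norm ?invr_ge0 ?qnorm_ge0 // divff ?gt_eqF.
Qed.

(** The kernel always contains 0, so it differs from [[set 0]] exactly when it has a nonzero vector,
    which can be normalized. *)
Lemma point_SspectrumP :
  point_Sspectrum A q <-> exists2 v : W, qnorm v = 1 & quadratic_op A q v = 0.
Proof.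
split=> [h|[v v1 Av0] E]; last first.
  have : [set v | qpoly_op A q v = 0] v := Av0.
  rewrite E => v0; move: v1.
  by rewrite v0 qnorm0 => /esym/eqP; rewrite oner_eq0.
apply: contra_notP h => h; apply/seteqP; split=> v /=; last first.
  by move=> ->; rewrite qpoly_opE linear0.
rewrite qpoly_opE => Av0; apply/eqP/negPn/negP => v0; apply: h.
exists (v *> qreal (qnorm v)^-1); first exact: qnorm_normalize.
by rewrite linearZ /= -[quadratic_fun A q v]/(quadratic_op A q v) Av0 scaler0.
Qed.

Lemma point_sub_approx_Sspectrum :
  point_Sspectrum A q -> approx_Sspectrum A q.
Proof.
move=> /point_SspectrumP[v v1 Av0]; exists (fun=> v); split=> //.
by rewrite qpoly_opE Av0 qnorm0; exact: cvg_cst.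
Qed.

(** If no positive [c] works, each 1/(n+1) fails at some vector; normalizing these vectors gives an
    approximate kernel sequence. *)
Lemma approx_SspectrumPn : ~ approx_Sspectrum A q ->
  exists2 c : R, 0 < c & forall v, c * qnorm v <= qnorm (quadratic_op A q v).
Proof.
apply: contra_notP => h.
have hv n : exists v : W,
    qnorm v = 1 /\ qnorm (quadratic_op A q v) <= n.+1%:R^-1.
  apply: contrapT => hn; apply: h; exists n.+1%:R^-1; first by rewrite invr_gt0.
  (* The bound is trivial at 0, so a vector violating it can be normalized. *)
  move=> v; have [->|v0] := eqVneq v 0; first by rewrite qnorm0 mulr0 qnorm_ge0.
  rewrite leNgt; apply/negP => hlt; apply: hn.
  exists (v *> qreal (qnorm v)^-1); split; first exact: qnorm_normalize.
  rewrite linearZ qnormZ qabs_real ger0_norm ?invr_ge0 ?qnorm_ge0 //.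
  by rewrite ler_pdivrMr ?qnorm_gt0 // ltW.
exists (fun n => sval (cid (hv n))); split=> [n|].
  by case: cid => v [].
apply: squeeze0 (@cvg_harmonic R) => n; rewrite qnorm_ge0 /=.
by case: cid => v [].
Qed.

(** On unit vectors the image norms stay at least [c], so they cannot tend to 0. *)
Lemma bounded_below_approx_Sspectrum (c : R) : 0 < c ->
  (forall v, c * qnorm v <= qnorm (quadratic_op A q v)) ->
  ~ approx_Sspectrum A q.
Proof.
move=> c0 hc [phi [phi1 /cvg0P/(_ c c0)[N /(_ N (leqnn N))]]].
rewrite ger0_norm ?qnorm_ge0 // qpoly_opE => /(le_lt_trans (hc _)).
by rewrite phi1 mulr1 ltxx.
Qed.
End Spectra.

Theorem theorem4p5 (R : realType) (L : glim R) (V : qHilbertType R)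
    (sepV : qseparable V) (A : bop V) :
  approx_Sspectrum A = approx_Sspectrum (berberian_op L A) /\
  approx_Sspectrum (berberian_op L A) = point_Sspectrum (berberian_op L A).
Proof.
have ap_p q : approx_Sspectrum A q -> point_Sspectrum (berberian_op L A) q.
  move=> [phi [phi1 hphi]]; apply/point_SspectrumP.
  have [y y1 Ty] := berberian_kernel L (T := quadratic_op A q) phi1 hphi.
  by exists y; rewrite // -berberian_quadratic.
have p_ap q : point_Sspectrum (berberian_op L A) q ->
    approx_Sspectrum (berberian_op L A) q.
  exact: point_sub_approx_Sspectrum.
have ap_ap q : approx_Sspectrum (berberian_op L A) q -> approx_Sspectrum A q.
  apply: contraPP => /approx_SspectrumPn[c c0 hc].
  apply: (bounded_below_approx_Sspectrum c0) => y.
  rewrite -berberian_quadratic.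
  exact: berberian_bounded_below (ltW c0) hc y.
(* The three inclusions form a cycle, which gives both equalities. *)
by split; apply/seteqP; split=> q; auto.
Qed.
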